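(* Let $n\geq 2$ be an integer and let $X$ be a $T_1$ $n$-Hausdorff topological space. Then $|X|\leq \psi w(X)^{\,l(X)\cdot n\text{-}\psi(X)}$.
   Context: Throughout $n\ge 2$ is an integer. The Hausdorff number $H(X)$ of a space $X$ is the least cardinal $\kappa$ such that for every $A\subseteq X$ with $|A|\geq\kappa$ there exist open neighbourhoods $U_a$ of $a$ ($a\in A$) with $\bigcap_{a\in A}U_a=\emptyset$. $X$ is $n$-Hausdorff if $H(X)\leq n$. For an $n$-Hausdorff space $X$, the $n$-pseudocharacter $n\text{-}\psi(X)$ is the minimum infinite cardinal $\kappa$ such that for each point $x\in X$ there is a collection $\{V(\alpha,x):\alpha<\kappa\}$ of open neighbourhoods of $x$ such that whenever $x_1,\dots,x_n\in X$ are $n$ different points, $\bigcap_{\alpha<\kappa}V(\alpha,x_1)\cap\dots\cap\bigcap_{\alpha<\kappa}V(\alpha,x_n)=\emptyset$. A family $\mathcal{B}$ of open subsets of $X$ is a $\psi$-base (pseudobase) if $\{x\}=\bigcap\{B\in\mathcal{B}:x\in B\}$ for every $x\in X$. For a $T_1$ space $X$, the pseudo weight is $\psi w(X)=\min\{|\mathcal{B}|:\mathcal{B}\text{ is a }\psi\text{-base for }X\}+\omega$. $l(X)$ is the Lindelöf number of $X$, multiplied by $\omega$ (so it is always infinite). *)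

(* Defs.v *)
From mathcomp Require Import all_boot all_classical topology.

Set Implicit Arguments.
Unset Strict Implicit.
Unset Printing Implicit Defensive.

Local Open Scope classical_set_scope.
Local Open Scope card_scope.

(* A cardinal is represented by a type, taken up to equinumerosity: sum, product
   and function type are cardinal sum, product and exponentiation. *)

Definition is_least_card (P : Type -> Prop) (K : Type) : Prop :=
  P K /\ forall K' : Type, P K' -> [set: K] #<= [set: K'].

(* A cardinal of least size satisfying P; the value is meaningful only if some
   cardinal satisfies P (see [least_cardP]). *)
Definition least_card (P : Type -> Prop) : Type :=
  if pselect (exists K, is_least_card P K) is left e then projT1 (cid e)
  else unit.

Section LeastCard.

Lemma inj_card_leT (A B : Type) (f : A -> B) :
  injective f -> [set: A] #<= [set: B].
Proof.
move=> fI; have E : f @` setT #= [set: A].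
  by apply: inj_card_eq => x y _ _; exact: fI.
by rewrite -(card_le_eql E); exact: card_leT.
Qed.

Lemma card_leT_inj (A B : Type) :
  [set: A] #<= [set: B] -> exists f : A -> B, injective f.
Proof.
move=> /card_leP[f].
have fP (x : A) : x \in [set: A] by exact: mem_set.
exists (fun x => val (f (SigSub (fP x)))) => x y /val_inj fxy.
by have /(congr1 val) := inj (mem_set I) (mem_set I) fxy.
Qed.

(* A maximal set of sections with injective coordinates projects onto some F i. *)
Lemma min_card_family (I : Type) (i0 : I) (F : I -> Type) :
  exists i, forall j, [set: F i] #<= [set: F j].
Proof.
pose T := forall i, F i.
pose Q (S : set T) := forall i f g, S f -> S g -> f i = g i -> f = g.
have [C CQ totC|S [SQ Smax]] := @Zorn_bigcup T Q.
  move=> i f g [S1 CS1 S1f] [S2 CS2 S2g].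
  by have [S12|S21] := totC _ _ CS1 CS2;
    [exact: (CQ _ CS2 i) (S12 _ S1f) S2g|exact: (CQ _ CS1 i) S1f (S21 _ S2g)].
have [i iS] : exists i, forall x : F i, exists2 f, S f & f i = x.
  apply: contrapT => /forallNP nS.
  have {}nS i : {x : F i | forall f, S f -> f i <> x}.
    apply: cid; apply: contrapT => /forallNP nx; apply: (nS i) => x.
    apply: contrapT => nf; apply: (nx x) => f Sf fix_; apply: nf.
    by exists f.
  pose h : T := fun i => projT1 (nS i).
  have hP i f : S f -> f i <> h i by move=> Sf; exact: (projT2 (nS i)).
  apply: (Smax (S `|` [set h])).
    split; first by move=> f Sf; left.
    by move=> SS; exact: (hP i0 h (SS h (or_intror erefl))).
  move=> i f g [Sf|->] [Sg|->] //; first exact: SQ Sf Sg.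
    by move=> fh; case: (hP _ _ Sf fh).
  by move=> gh; case: (hP _ _ Sg (esym gh)).
have {}iS x : {f : T | S f /\ f i = x} by apply: cid; case: (iS x) => f; exists f.
exists i => j; apply: (@inj_card_leT _ _ (fun x => projT1 (iS x) j)) => x y.
have [Sx Ex] := projT2 (iS x); have [Sy Ey] := projT2 (iS y).
by move=> /(SQ _ _ _ Sx Sy) fxy; rewrite -Ex -Ey fxy.
Qed.

Lemma card_leT_total (A B : Type) :
  [set: A] #<= [set: B] \/ [set: B] #<= [set: A].
Proof.
have [[] H] := min_card_family true (fun b : bool => if b then A else B).
  by left; exact: (H false).
by right; exact: (H true).
Qed.

Lemma ex_least_card (P : Type -> Prop) (K : Type) :
  P K -> exists L, is_least_card P L.
Proof.
move=> PK; pose Q (A : set K) := exists2 L, P L & A #= [set: L].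
have QT : Q setT by exists K => //; exact: card_eqxx.
pose I := {A : set K | Q A}.
have sE (A : set K) : [set: A] #= A.
  have E : A = [set val x | x in [set: A]].
    apply/seteqP; split=> [x Ax|_ [x _ <-]]; last exact: set_valP.
    by exists (SigSub (mem_set Ax)).
  rewrite card_eq_sym [X in X #= _]E.
  by apply: inj_card_eq => x y _ _; exact: val_inj.
have [[A [L PL AL]] Amin] :=
  min_card_family (exist _ _ QT : I) (fun A : I => sval A).
have KL : forall B, Q B -> [set: L] #<= B.
  move=> B QB; have := Amin (exist _ B QB) => /=.
  rewrite (card_le_eqr (sE B)) (card_le_eql (sE A)).
  by rewrite (card_le_eql AL).
exists L; split=> // L' PL'.
have [LK|KL'] := card_leT_total L' K; last first.
  by apply: card_le_trans KL'; exact: KL.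
have [f fI] := card_leT_inj LK.
have E : f @` setT #= [set: L'] by apply: inj_card_eq => x y _ _; exact: fI.
by rewrite -(card_le_eqr E); apply: KL; exists L'.
Qed.

Lemma least_cardP (P : Type -> Prop) (K : Type) :
  P K -> is_least_card P (least_card P).
Proof.
move=> /ex_least_card e; rewrite /least_card.
by case: pselect => // e'; exact: (projT2 (cid e')).
Qed.

End LeastCard.

Section CardinalFunctions.
Variable X : topologicalType.

Definition has_separated_nbhds (K : Type) : Prop :=
  forall A : set X, [set: K] #<= A ->
    exists U : X -> set X,
      (forall a, A a -> open_nbhs a (U a)) /\ \bigcap_(a in A) U a = set0.

Definition hausdorff_number : Type := least_card has_separated_nbhds.

Definition n_hausdorff (n : nat) : Prop := [set: hausdorff_number] #<= `I_n.

Definition n_pseudochar_bound (n : nat) (K : Type) : Prop :=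
  [set: nat] #<= [set: K] /\
  exists V : K -> X -> set X,
    (forall a x, open_nbhs x (V a x)) /\
    forall x : 'I_n -> X, injective x ->
      \bigcap_(i in [set: 'I_n]) \bigcap_(a in [set: K]) V a (x i) = set0.

Definition n_pseudochar (n : nat) : Type := least_card (n_pseudochar_bound n).

Definition pseudobase (B : set (set X)) : Prop :=
  (forall U, B U -> open U) /\
  forall x, [set x] = \bigcap_(U in [set U | B U /\ U x]) U.

Definition pseudobase_card (K : Type) : Prop :=
  exists B : set (set X), pseudobase B /\ B #= [set: K].

Definition pseudoweight : Type := (least_card pseudobase_card + nat)%type.

Definition lindelof_bound (K : Type) : Prop :=
  forall C : set (set X),
    (forall U, C U -> open U) -> \bigcup_(U in C) U = setT ->
    exists D : set (set X),
      [/\ D `<=` C, \bigcup_(U in D) U = setT & D #<= [set: K]].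

(* The factor nat makes the product infinite as soon as X is nonempty; for empty
   X the empty subcover always suffices and the product is empty. *)
Definition lindelof_number : Type := (least_card lindelof_bound * nat)%type.

Lemma hausdorff_numberP : is_least_card has_separated_nbhds hausdorff_number.
Proof.
apply: (@least_cardP _ (X -> Prop)) => A /card_le_trans/(_ (card_leT A)).
move=> /card_leT_inj[f fI]; exfalso.
pose D x := exists2 S, f S = x & ~ S x.
have nD : ~ D (f D) by move=> [S /fI -> nS]; apply: (nS); exists D.
by apply: (nD); exists D.
Qed.

Lemma n_hausdorffE n : n_hausdorff n <-> has_separated_nbhds 'I_n.
Proof.
have E : [set: 'I_n] #= `I_n.
  have <- : [set val i | i in [set: 'I_n]] = `I_n.
    by apply/seteqP; split=> [_ [i _ <-]|k kn] //=; exists (Ordinal kn).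
  by rewrite card_eq_sym; apply: inj_card_eq => x y _ _; exact: val_inj.
have [HP Hmin] := hausdorff_numberP.
split=> [Hn A nA|/Hmin]; last by rewrite /n_hausdorff (card_le_eqr E).
apply: HP; apply: card_le_trans nA; by rewrite (card_le_eqr E).
Qed.

Lemma n_pseudocharP n : n_hausdorff n ->
  is_least_card (n_pseudochar_bound n) (n_pseudochar n).
Proof.
move=> /n_hausdorffE Hn; apply: (@least_cardP _ ((X -> Prop) + nat)%type).
split; first by apply: (@inj_card_leT _ _ inr) => x y [].
exists (fun a x => if a is inl U then if pselect (open_nbhs x U) then U else setT
                   else setT).
split=> [[U|k] x|x xI]; [by case: pselect => //= _; split=> //; exact: openT|
  by split=> //; exact: openT|].
have [|U [Uo U0]] := Hn (range x).
  have E : range x #= [set: 'I_n] by apply: inj_card_eq => i j _ _; exact: xI.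
  by rewrite (card_le_eqr E).
rewrite -subset0 -U0 => y yV _ [i _ <-].
have := yV i I (inl (U (x i))) I.
by case: pselect => //; case; apply: Uo; exists i.
Qed.

Lemma pseudobase_cardP : accessible_space X ->
  is_least_card pseudobase_card (least_card pseudobase_card).
Proof.
move=> T1; apply: (@least_cardP _ {U : X -> Prop | `[< open (U : set X) >]}).
exists [set U | open U]; split.
  split=> // x; apply/seteqP; split=> [_ -> U [_]//|y xy].
  apply: contrapT => /eqP nyx.
  have [|U [Uo Uxy]] := T1 x y; first by rewrite eq_sym.
  by case: Uxy; rewrite !inE => Ux; apply; exact: (xy U).
have <- : [set sval x | x in
    [set: {U : X -> Prop | `[< open (U : set X) >]}]] = [set U | open U].
  apply/seteqP; split=> [_ [[U /= Uo] _ <-]|U Uo]; first exact/asboolP.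
  by exists (exist _ U (asboolT Uo)).
by apply: inj_card_eq => -[U Uo] [V Vo] _ _ /= UV; exact: eq_exist.
Qed.

Lemma lindelof_numberP :
  is_least_card lindelof_bound (least_card lindelof_bound).
Proof.
apply: (@least_cardP _ (X -> Prop)) => C _ Ccov.
by exists C; split=> //; exact: card_leT.
Qed.

End CardinalFunctions.

(* Main.v *)
Require Import Defs.
From mathcomp Require Import all_boot all_classical topology.

Local Open Scope classical_set_scope.
Local Open Scope card_scope.

(** Let [L], [P] and [M] have the size of the Lindelof number, of the
    n-pseudocharacter and of a pseudobase, and let [V a x] ([a : P]) witness the
    n-pseudocharacter. For every [x] and [a], the set [V a x] together with the
    members of the pseudobase that miss [x] cover [X], so at most [L] members of
    the pseudobase miss [x] and cover the complement of [V a x]. Recording these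
    members for all [a] attaches to [x] a code [c x : L * P -> option M]
    ([ex_complement_code]).

    If [n] distinct points shared one code, each of them would be missed by
    everything that the code lists, hence would lie in every [V a (x i)], against
    the choice of [V]. So every fibre of [c] has fewer than [n] points; in
    particular it is countable, and a natural number tells its points apart
    ([countable_fibers_index]). The pair of the code and of this number
    determines [x]; both fit in a single function [(L * nat) * P -> M + nat],
    the number being stored where the coordinate in [nat] is 0 and the code
    where it is positive. No cardinal arithmetic is needed. *)

(** A set of size at most [K] is listed by [K], possibly with extra values; the
    point [t0] is a default value, for the indices that list nothing. *)
Lemma card_leT_range {T K : Type} (t0 : T) {A : set T} :
  A #<= [set: K] -> exists f : K -> T, A `<=` range f.
Proof.
move=> /card_leP[g].
exists (fun k => if pselect (exists u : A, val (g u) = k) is left e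
                 then val (projT1 (cid e)) else t0) => t At.
exists (val (g (SigSub (mem_set At)))) => //.
case: pselect => [e|[]]; last by exists (SigSub (mem_set At)).
have /val_inj gE := projT2 (cid e).
by rewrite (inj (mem_set I) (mem_set I) gE).
Qed.

(** The index is chosen as a function of the value of [c], so that points of one
    fibre are numbered by the same injection. *)
Lemma countable_fibers_index {T C : Type} (c : T -> C) :
  (forall z, countable (c @^-1` [set z])) ->
  exists h : T -> nat, forall x y, c x = c y -> h x = h y -> x = y.
Proof.
move=> cc; have {}cc z := cid (elimT (countable_injP _) (cc z)).
exists (fun x => projT1 (cc (c x)) x) => x y cxy; rewrite cxy.
by apply: (projT2 (cc (c y))); apply: mem_set.
Qed.

Lemma countable_of_no_injection {T : Type} (n : nat) (A : set T) :
  (forall x : 'I_n -> T, injective x -> ~ (forall i, A (x i))) -> countable A.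
Proof.
move=> noinj; apply: finite_set_countable; apply: contrapT.
move=> /infiniteP/card_leP[g].
pose m (i : 'I_n) : [set: nat] := SigSub (mem_set (I : [set: nat] i)).
apply: (noinj (fun i => val (g (m i)))) => [i j /val_inj gij|i].
  have /(congr1 val) /= mij := inj (mem_set I) (mem_set I) gij.
  exact: val_inj.
exact: set_valP.
Qed.

Section ComplementCode.
Context {X : topologicalType} {L P M : Type}.

(** The Lindelof property applied to an open neighbourhood [W] of [x] and to the
    members of a pseudobase [B] that miss [x]. *)
Lemma lindelof_cover_complement (B : set (set X)) (W : set X) (x : X) :
  lindelof_bound X L -> pseudobase B -> open_nbhs x W ->
  exists f : L -> set X, forall y, ~ W y ->
    exists l, [/\ B (f l), ~ f l x & f l y].
Proof.
move=> lL [Bo Bx] [Wo Wx].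
have [U [->|[BU _]]||D [DC Dcov DL]] :=
  lL [set U | U = W \/ (B U /\ ~ U x)] => //; first exact: Bo.
  rewrite -subTset => y _.
  have [Wy|nWy] := pselect (W y); first by exists W => //; left.
  apply: contrapT => nU; apply: nWy.
  suff -> : y = x by [].
  apply/esym; have : [set y] x; last by [].
  rewrite Bx => U [BU Uy].
  by apply: contrapT => nUx; apply: nU; exists U => //; right.
have [f Df] := card_leT_range set0 DL; exists f => y nWy.
have [U DU Uy] : (\bigcup_(U in D) U) y by rewrite Dcov.
have [l _ fl] := Df _ DU; exists l; rewrite fl.
by have [UW|[BU nUx]] := DC _ DU; first by rewrite UW in Uy.
Qed.

(** The sets listed by the code of [x] miss [x] and cover the complement of the
    intersection of the [V a x]. *)
Lemma ex_complement_code (V : P -> X -> set X) :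
  lindelof_bound X L -> pseudobase_card X M ->
  (forall a x, open_nbhs x (V a x)) ->
  exists (b : M -> set X) (c : X -> L * P -> option M),
    (forall x q m, c x q = Some m -> ~ b m x) /\
    (forall x y, (forall q m, c x q = Some m -> ~ b m y) ->
       forall a, V a x y).
Proof.
move=> lL [B [Bpb BM]] Vo.
have [b Bb] : exists b : M -> set X, B `<=` range b.
  by apply: (card_leT_range set0); rewrite (card_le_eql BM).
have fP x a := cid (lindelof_cover_complement B _ x lL Bpb (Vo a x)).
pose f x a := projT1 (fP x a).
pose listed x (q : L * P) m := b m = f x q.2 q.1 /\ ~ b m x.
pose c x q := if pselect (exists m, listed x q m) is left e
              then Some (projT1 (cid e)) else None.
have cP x q m : c x q = Some m -> listed x q m.
  rewrite /c; case: pselect => // e [<-]; exact: projT2 (cid e).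
exists b, c; split=> [x q m /cP[]//|x y ny a].
apply: contrapT => /(projT2 (fP x a))[l]; rewrite -/(f x a) => -[Bf nfx fy].
have [m _ bm] := Bb _ Bf.
have [m' cm'] : exists m', c x (l, a) = Some m'.
  rewrite /c; case: pselect => [e|[]]; first by exists (projT1 (cid e)).
  by exists m; split=> /=; rewrite bm.
by apply: (ny _ _ cm'); have [-> _] := cP _ _ _ cm'.
Qed.

End ComplementCode.

Lemma lindelof_bound_inhabited {X : topologicalType} {L : Type} (x : X) :
  lindelof_bound X L -> inhabited L.
Proof.
move=> /(_ [set setT])[U ->||D [_ Dcov /(card_leT_range set0)[f Df]]].
- exact: openT.
- by rewrite bigcup_set1.
have [U DU _] : (\bigcup_(U in D) U) x by rewrite Dcov.
by have [l _ _] := Df _ DU.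
Qed.

(** The bound holds for any [L], [P] and [M] that bound the three invariants. *)
Lemma card_le_pseudobase_exp (n : nat) (X : topologicalType) (L P M : Type) :
  (0 < n)%N -> lindelof_bound X L -> n_pseudochar_bound X n P ->
  pseudobase_card X M ->
  [set: X] #<= [set: (L * nat) * P -> M + nat].
Proof.
move=> n0 lL [/card_leT_inj[p _] [V [Vo V0]]] pM.
have [b [c [cx cV]]] := ex_complement_code _ lL pM Vo.
have [h hP] : exists h : X -> nat, forall x y, c x = c y -> h x = h y -> x = y.
  apply: countable_fibers_index => z.
  apply: (countable_of_no_injection n) => x xI xz.
  pose x0 := x (Ordinal n0).
  suff : (\bigcap_(i in [set: 'I_n]) \bigcap_(a in [set: P]) V a (x i)) x0.
    by rewrite V0.
  move=> i _ a _; apply: cV => q m.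
  by rewrite (xz i) -(xz (Ordinal n0)); exact: cx.
pose code x (q : (L * nat) * P) : M + nat :=
  if q.1.2 is 0 then inr (h x)
  else if c x (q.1.1, q.2) is Some m then inl m else inr 0.
apply: (@inj_card_leT _ _ code) => x y xy.
apply: hP.
  apply/funext => -[l a]; have := congr1 (@^~ ((l, 1), a)) xy.
  by rewrite /code /=; case: (c x _) => [m|]; case: (c y _) => [m'|] // [->].
have [l] := lindelof_bound_inhabited x lL.
by have [] := congr1 (@^~ ((l, 0), p 0)) xy.
Qed.

Theorem corollary2p10 (n : nat) (X : topologicalType) :
  (2 <= n)%N -> accessible_space X -> n_hausdorff X n ->
  [set: X] #<= [set: lindelof_number X * n_pseudochar X n -> pseudoweight X].
Proof.
move=> n2 T1 Hn; apply: (@card_le_pseudobase_exp n); first exact: ltnW.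
- exact: (lindelof_numberP X).1.
- exact: (n_pseudocharP Hn).1.
- exact: (pseudobase_cardP T1).1.
Qed.
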